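(* Let $u,v$ be integers with $v\geq u\geq 9$, let $\beta_{u,v}=[\overline{u,v}]$, $\tau_1=[\overline{u,v}]$, $\tau_2=[\overline{v,u}]$ and $\varphi=(1+\sqrt5)/2$. Then the Hurwitz constant of $\beta_{u,v}$ is $$K_{\beta_{u,v}}=\frac{2(\tau_1-\varphi^2)\left(1+\frac{\tau_2}{\varphi^2}\right)}{\left(\varphi+\frac{1}{\varphi}\right)(\tau_1\tau_2+1)}.$$
   Context: $[\overline{u,v}]$ denotes the purely periodic (regular) continued fraction $[u,v,u,v,\dots]=u+\cfrac{1}{v+\cfrac{1}{u+\cdots}}$. $x^{\sigma}$ denotes the Galois conjugate of a quadratic number $x$. For a real quadratic number $\alpha$, let $\Theta_{\alpha}=PSL(2,\mathbb{Z})\{\alpha,\alpha^{\sigma}\}$ be the union of the orbits of $\alpha$ and $\alpha^\sigma$ under the action of $PSL(2,\mathbb{Z})$ by fractional linear transformations. For a real number $\xi\notin\mathbb{Q}\cup\Theta_\alpha$ put $$c_{\alpha}\xi:=\liminf_{\beta\in\Theta_{\alpha},\ |\beta-\beta^{\sigma}|\rightarrow 0}\ 2\,\frac{|\xi-\beta|}{|\beta-\beta^{\sigma}|}.$$ The quadratic Lagrange spectrum of $\alpha$ is $Sp_{\alpha}:=\{c_{\alpha}\xi : \xi\in\mathbb{R}\setminus(\mathbb{Q}\cup\Theta_\alpha)\}$, and the Hurwitz constant $K_\alpha$ of $\alpha$ is the maximum of $Sp_\alpha$. *)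

(* Defs.v *)
From mathcomp Require Import all_boot all_order all_algebra.
From mathcomp Require Import all_classical all_reals all_analysis.

Set Implicit Arguments.
Unset Strict Implicit.
Unset Printing Implicit Defensive.

Import Order.TTheory GRing.Theory Num.Theory.
Import numFieldNormedType.Exports.

Local Open Scope classical_set_scope.
Local Open Scope ring_scope.

(* cf_convergent a n = [a 0, a 1, ..., a n] *)
Fixpoint cf_convergent (R : realType) (a : nat -> int) (n : nat) : R :=
  if n is m.+1 then (a 0%N)%:~R + (cf_convergent R (fun k => a k.+1) m)^-1
  else (a 0%N)%:~R.

Definition cf (R : realType) (a : nat -> int) : R :=
  limn (fun n => cf_convergent R a n).

Definition periodic_cf2 (R : realType) (u v : int) : R :=
  cf R (fun k => if odd k then v else u).

(* x and y are the two roots of an irreducible monic quadratic over Q: x is a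
   real quadratic number and y is its Galois conjugate. *)
Definition is_galois_conj (R : realType) (x y : R) : Prop :=
  exists p : {poly rat},
    irreducible_poly p /\ map_poly ratr p = ('X - x%:P) * ('X - y%:P).

(* Junk value x if x is not a real quadratic number. *)
Definition galois_conj (R : realType) (x : R) : R :=
  xget x [set y | is_galois_conj x y].

(* On irrational x, which are the only arguments used below, the denominator
   of an M of determinant 1 does not vanish. *)
Definition mobius (R : realType) (M : 'M[int]_2) (x : R) : R :=
  ((M 0 0)%:~R * x + (M 0 1)%:~R) / ((M 1 0)%:~R * x + (M 1 1)%:~R).

(* M and -M act identically, so SL(2,Z) and PSL(2,Z) have the same orbits. *)
Definition Theta (R : realType) (alpha : R) : set R :=
  [set beta | exists M : 'M[int]_2, \det M = 1 /\
    (beta = mobius M alpha \/ beta = mobius M (galois_conj alpha))].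

(* "beta in Theta alpha and |beta - beta^sigma| -> 0" *)
Definition Theta_filter (R : realType) (alpha : R) : set_system R :=
  filter_from [set e : R | 0 < e]
    (fun e => [set beta | Theta alpha beta /\
                          `|beta - galois_conj beta| < e]).

Definition approx_constant (R : realType) (alpha xi : R) : \bar R :=
  limf_einf
    (fun beta : R => (2 * (`|xi - beta| / `|beta - galois_conj beta|))%:E)
    (Theta_filter alpha).

Definition quadratic_Lagrange_spectrum (R : realType) (alpha : R) :
    set (\bar R) :=
  [set approx_constant alpha xi | xi in ~` (@rational R `|` Theta alpha)].

Definition is_Hurwitz_constant (R : realType) (alpha : R) (K : \bar R) : Prop :=
  quadratic_Lagrange_spectrum alpha K /\
  ubound (quadratic_Lagrange_spectrum alpha) K.

Definition golden_ratio (R : realType) : R := (1 + Num.sqrt 5) / 2.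

(* Main.v *)
Require Import Defs.
From mathcomp Require Import all_boot all_order all_algebra.
From mathcomp Require Import all_classical all_reals all_analysis.
From mathcomp Require Import zify ring lra.

Set Implicit Arguments.
Unset Strict Implicit.
Unset Printing Implicit Defensive.

Import Order.TTheory GRing.Theory Num.Theory.
Import numFieldNormedType.Exports.

Local Open Scope classical_set_scope.
Local Open Scope ring_scope.

(* Write a = tau1 and d = 1 / tau2. The Galois conjugate of a is -d = u - a,
   and since x |-> u - x has determinant -1, Theta a is the whole GL(2,Z)-orbit
   of a. If (beta, beta^sigma) = g (t, t') and xi = g x, then, r being minus
   the preimage of infinity under g,
     2 |xi - beta| / |beta - beta^sigma| = 2 |x - t| |t' + r| / ((a + d) (x + r)).

   Upper bound: let x run through the complete quotients of xi and r through
   the corresponding ratios of consecutive denominators, so that r is in [0, 1].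
   Whenever x >= 2, one of the images a, a - 1, a + 2 - u, -a of a may be taken
   for t, giving a value below the constant. If finally x < 2, then xi is
   equivalent to the golden ratio phi, x = phi, r tends to 1 / phi, and t = a - 1
   gives the constant in the limit.

   Lower bound at xi = phi: |phi - beta| |phi^sigma - beta^sigma| is, up to
   normalization, the distance between the integer m = uvB + 2vC - 2uA and
   +- sqrt 5 v (a + d), where (A, B, C) is the pull-back by g of the form
   X^2 - X - 1, of discriminant 5. The reflections X |-> u - X and
   1/X |-> -v - 1/X preserve |m|, and a descent by them shows that m avoids the
   interval between uv + 2u + 2v and 3uv - 2v + 2u. *)

(** * Binary quadratic forms of discriminant 5 *)

Lemma disc5_cases (A B C : int) : B ^+ 2 - 4 * A * C = 5 -> 0 <= B ->
  [\/ B = 1 /\ A * C = -1, B = 3 /\ A * C = 1, B = 5 /\ A * C = 5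
    | 6 <= B /\ 0 < A * C].
Proof.
rewrite -mulrA => h B0; set p := A * C in h *.
have [/eqP B1|B1] := boolP (B == 1).
  by constructor 1; split => //; move: h; rewrite B1; lia.
have [/eqP B3|B3] := boolP (B == 3).
  by constructor 2; split => //; move: h; rewrite B3; lia.
have [/eqP B5|B5] := boolP (B == 5).
  by constructor 3; split => //; move: h; rewrite B5; lia.
have [B6|B6] := leP 6 B; first by constructor 4; split => //; nia.
exfalso.
(* Only odd B remain possible, since B^2 is congruent to 5 modulo 4. *)
have : B = 0 \/ B = 2 \/ B = 4 by lia.
by case=> [E|[E|E]]; rewrite E in h; lia.
Qed.

Lemma mul_eq5 (A C : int) : A * C = 5 -> 0 < A ->
  (A = 1 /\ C = 5) \/ (A = 5 /\ C = 1).
Proof.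
move=> h A0; have C0 : 0 < C by nia.
have A5 : A <= 5 by nia.
have : A = 1 \/ A = 2 \/ A = 3 \/ A = 4 \/ A = 5 by lia.
by move=> [E|[E|[E|[E|E]]]]; subst A; lia.
Qed.

Lemma mul_eq1 (A C : int) : A * C = 1 -> 0 < A -> A = 1 /\ C = 1.
Proof.
move=> h A0; have C0 : 0 < C by nia.
have A5 : A <= 1 by nia.
have E : A = 1 by lia.
by subst A; lia.
Qed.

Lemma mul_eqN1 (A C : int) : A * C = -1 -> (A = 1 /\ C = -1) \/ (A = -1 /\ C = 1).
Proof.
move=> h; have h1 : `|A| * `|C| = 1 by rewrite -normrM h.
have A0 : 0 < `|A| by rewrite normr_gt0; apply/eqP => E; rewrite E mul0r in h.
have [] := mul_eq1 h1 A0; case: (ger0P A) => _ E _; [left|right]; split; lia.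
Qed.

Section Gap.
Variables u v : int.
Hypotheses (hu : 9 <= u) (huv : u <= v).

(* v (2 A a a' + B (a + a') + 2 C), where a and a' are the roots of
   v X^2 - u v X - u. *)
Definition pairing (A B C : int) := u * v * B + 2 * v * C - 2 * u * A.

Definition gap (m : int) :=
  `|m| <= u * v + 2 * u + 2 * v \/ 3 * u * v - 2 * v + 2 * u <= `|m|.

(* B + u A and B - v C change sign under the two reflections. Their signs tell
   whether the geodesics attached to the two forms meet. *)
Lemma gap_disjoint A B C : B ^+ 2 - 4 * A * C = 5 ->
  0 <= B + u * A -> B - v * C <= 0 -> gap (pairing A B C).
Proof.
move=> h ha hb; rewrite /gap /pairing.
have w9u : 9 * u <= u * v by nia.
have w9v : 9 * v <= u * v by nia.
have [B0|B0] := leP 0 B.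
- case: (disc5_cases h B0) => [[E1 E2]|[E1 E2]|[E1 E2]|[E1 E2]].
  + by left; case: (mul_eqN1 E2) => -[-> ->]; lia.
  + have A0 : 0 < A by nia.
    by right; case: (mul_eq1 E2 A0) => -> ->; lia.
  + have A0 : 0 < A by nia.
    by right; case: (mul_eq5 E2 A0) => -[-> ->]; lia.
  + right.
    have C0 : 0 < C by nia.
    have A0 : 0 < A by nia.
    (* From B <= v C follows 4 A C < B^2 <= B v C, and C cancels. So 2 u A takes away at most half
       of u v B, which leaves at least 3 u v. *)
    have h4 : 4 * A <= B * v by nia.
    have h5 : 2 * (2 * u * A) <= u * v * B by nia.
    have h6 : u * v * 6 <= u * v * B by nia.
    by have := ler_norm (u * v * B + 2 * v * C - 2 * u * A); nia.
- have h' : (- B) ^+ 2 - 4 * A * C = 5 by rewrite sqrrN.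
  have B0' : 0 <= - B by lia.
  case: (disc5_cases h' B0') => [[E1 E2]|[E1 E2]|[E1 E2]|[E1 E2]].
  + have -> : B = -1 by lia.
    by left; case: (mul_eqN1 E2) => -[-> ->]; lia.
  (* The form (1, -3, 1) attains the upper end of the gap. *)
  + have -> : B = -3 by lia.
    have A0 : 0 < A by nia.
    by right; case: (mul_eq1 E2 A0) => -> ->; lia.
  + have -> : B = -5 by lia.
    have A0 : 0 < A by nia.
    by right; case: (mul_eq5 E2 A0) => -[-> ->]; lia.
  + right.
    have A0 : 0 < A by nia.
    have C0 : 0 < C by nia.
    have h4 : 4 * C <= - B * u by nia.
    have h5 : 2 * (2 * v * C) <= u * v * - B by nia.
    have h6 : u * v * 6 <= u * v * - B by nia.
    have := ler_norm (- (u * v * B + 2 * v * C - 2 * u * A)); rewrite normrN; nia.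
Qed.

(** The last two hypotheses say that neither reflection brings the form closer to the two fixed
    geodesics. If A C > 0, they bound a sum of nonnegative terms containing v u^2 A^2 by 5 v, or one
    containing u v^2 C^2 by 5 u, which is absurd for u, v >= 9. So A C = -1 and B = 1 or -1, whence
    m is small. *)
Lemma gap_crossing A B C : B ^+ 2 - 4 * A * C = 5 ->
  0 < B + u * A -> 0 < B - v * C ->
  2 * (B + u * A) <= (u * v + 2) * (B - v * C) ->
  2 * (B - v * C) <= (u * v + 2) * (B + u * A) ->
  gap (pairing A B C).
Proof.
move=> h ha hb ra rb; rewrite /gap /pairing.
have w9u : 9 * u <= u * v by nia.
have w9v : 9 * v <= u * v by nia.
have small : A * C = -1 -> B = 1 \/ B = -1 -> 
  `|u * v * B + 2 * v * C - 2 * u * A| <= u * v + 2 * u + 2 * v.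
  by move=> E; case: (mul_eqN1 E) => -[-> ->] [] ->; lia.
have [/eqP AC|AC] := boolP (A * C == -1).
  by left; apply: small => //; nia.
have AC0 : 0 < A * C.
  have h' : `|B| ^+ 2 - 4 * A * C = 5 by rewrite real_normK ?num_real.
  by case: (disc5_cases h' (normr_ge0 B)) => [[_ E]|[_ ->]|[_ ->]|[_ ->]] //; lia.
exfalso.
have [A0|A0] := leP A 0.
- have An : A < 0 by nia.
  have Cn : C < 0 by nia.
  have : v * (B + u * A) ^+ 2 + v * u ^+ 2 * A ^+ 2 + 4 * u * A ^+ 2 <= 5 * v.
    rewrite -subr_ge0.
    have -> : 5 * v - (v * (B + u * A) ^+ 2 + v * u ^+ 2 * A ^+ 2 + 4 * u * A ^+ 2) =
        (-2 * A) * ((u * v + 2) * (B + u * A) - 2 * (B - v * C)).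
      by rewrite -h; ring.
    by apply: mulr_ge0; lia.
  have : v * 81 <= v * u ^+ 2 * A ^+ 2.
    have u2 : 81 <= u ^+ 2 by nia.
    have A2 : 1 <= A ^+ 2 by nia.
    have uA : 81 * 1 <= u ^+ 2 * A ^+ 2 by apply: ler_pM.
    by rewrite -mulrA ler_pM2l; lia.
  have : 0 <= v * (B + u * A) ^+ 2 by apply: mulr_ge0; [lia|exact: sqr_ge0].
  have : 0 <= 4 * u * A ^+ 2 by apply: mulr_ge0; [lia|exact: sqr_ge0].
  by lia.
- have Cn : 0 < C by nia.
  have : u * (B - v * C) ^+ 2 + u * v ^+ 2 * C ^+ 2 + 4 * v * C ^+ 2 <= 5 * u.
    rewrite -subr_ge0.
    have -> : 5 * u - (u * (B - v * C) ^+ 2 + u * v ^+ 2 * C ^+ 2 + 4 * v * C ^+ 2) =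
        (2 * C) * ((u * v + 2) * (B - v * C) - 2 * (B + u * A)).
      by rewrite -h; ring.
    by apply: mulr_ge0; lia.
  have : u * 81 <= u * v ^+ 2 * C ^+ 2.
    have v2 : 81 <= v ^+ 2 by nia.
    have C2 : 1 <= C ^+ 2 by nia.
    have vC : 81 * 1 <= v ^+ 2 * C ^+ 2 by apply: ler_pM.
    by rewrite -mulrA ler_pM2l; lia.
  have : 0 <= u * (B - v * C) ^+ 2 by apply: mulr_ge0; [lia|exact: sqr_ge0].
  have : 0 <= 4 * v * C ^+ 2 by apply: mulr_ge0; [lia|exact: sqr_ge0].
  by lia.
Qed.

Lemma pairingN A B C : pairing (- A) (- B) (- C) = - pairing A B C.
Proof. by rewrite /pairing; ring. Qed.

Lemma gapN m : gap (- m) -> gap m.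
Proof. by rewrite /gap normrN. Qed.

(** Descent on |B + u A| + |B - v C|: each reflection negates one of the two numbers, subtracts u v
    + 2 times it from the other, and preserves pairing and discriminant. *)
Lemma gap_pairing A B C : B ^+ 2 - 4 * A * C = 5 -> gap (pairing A B C).
Proof.
have [n] : exists n, (absz (B + u * A)%R + absz (B - v * C)%R <= n)%N.
  by eexists; exact: leqnn.
elim: n A B C => [|n IH] A B C le_n h.
  by apply: gap_disjoint => //; lia.
wlog a0 : A B C le_n h / 0 <= B + u * A.
  move=> H; have [a0|a0] := leP 0 (B + u * A); first exact: H.
  apply: gapN; rewrite -pairingN; apply: H; [lia|by rewrite -h; ring|lia].
have [b0|b0] := leP (B - v * C) 0; first exact: gap_disjoint.
have [a1|a1] := leP (B + u * A) 0.
  by apply: gapN; rewrite -pairingN; apply: gap_disjoint;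
    [rewrite -h; ring|lia|lia].
(* For positive a = B + u A and b = B - v C, the reflection replaces a by a - (u v + 2) b, which is
   smaller in absolute value exactly when 2 a > (u v + 2) b. *)
have [ra|ra] := leP (2 * (B + u * A)) ((u * v + 2) * (B - v * C)); last first.
  have <- : pairing (A - B * v + C * v ^+ 2) (2 * C * v - B) C = pairing A B C.
    by rewrite /pairing; ring.
  apply: IH => //; last by rewrite -h; ring.
  rewrite (_ : 2 * C * v - B - v * C = - (B - v * C)); last by ring.
  rewrite (_ : 2 * C * v - B + u * (A - B * v + C * v ^+ 2) =
    B + u * A - (u * v + 2) * (B - v * C)); last by ring.
  have : 0 < (u * v + 2) * (B - v * C) by apply: mulr_gt0 => //; nia.
  by lia.
have [rb|rb] := leP (2 * (B - v * C)) ((u * v + 2) * (B + u * A)).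
  exact: gap_crossing.
have <- : pairing A (- B - 2 * u * A) (A * u ^+ 2 + B * u + C) = pairing A B C.
  by rewrite /pairing; ring.
apply: IH => //; last by rewrite -h; ring.
rewrite (_ : - B - 2 * u * A + u * A = - (B + u * A)); last by ring.
rewrite (_ : - B - 2 * u * A - v * (A * u ^+ 2 + B * u + C) =
  B - v * C - (u * v + 2) * (B + u * A)); last by ring.
have : 0 < (u * v + 2) * (B + u * A) by apply: mulr_gt0 => //; nia.
by lia.
Qed.

End Gap.

(** * Images of tau1 close to a geodesic *)

Section Level.
Variables (R : realFieldType) (a d s : R).
Hypothesis params : [/\ 9 <= a, 0 < d, a * d <= 1, 0 < s & s * s = 5].

(* With s = sqrt 5, this is |x - t| |t' + r| / (x + r) at x = phi, r = 1 / phi,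
   t = a - 1, t' = - d - 1. *)
Definition level := (a - (3 + s) / 2) * (d + (3 - s) / 2) / s.

(* 377 / 144, 55 / 144 and 161 / 72 approximate phi^2, phi^-2 and sqrt 5. *)
Lemma level_ge :
  (a - 377 / 144) * (d + 55 / 144) / (161 / 72) <= level.
Proof.
case: params => ha hd0 had s0 ss.
rewrite /level.
have s1 : s <= 161 / 72.
  rewrite leNgt; apply/negP => h.
  have h2 : 161 / 72 * (161 / 72) < s * s by apply: ltr_pM; lra.
  lra.
have si : (161 / 72)^-1 <= s^-1 by rewrite lef_pV2 ?posrE; lra.
apply: ler_pM; [apply: mulr_ge0; lra|rewrite invr_ge0; lra| |exact: si].
by apply: ler_pM; lra.
Qed.

(** All three weaken [level_ge]: drop d; then put a = 9; or expand the product and use 377 * 55 =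
    20735 < 144^2. *)
Lemma level_facts : [/\ (55 / 322) * (a - 377 / 144) <= level, 27 / 25 <= level &
   (a * d + 55 / 144 * a - 377 / 144 * d - 1) * (72 / 161) <= level].
Proof.
case: params => ha hd0 had s0 ss.
have := level_ge; move: level => l h2.
have h1 : d <= 1 / 9 by nra.
have h3 : l * 161 >= 72 * ((a - 377 / 144) * (d + 55 / 144)).
  by move: h2; rewrite ler_pdivrMr => [h2|]; lra.
have ad0 : 0 <= a * d by apply: mulr_ge0; lra.
split; nra.
Qed.

End Level.

Section LevelBounds.
Variables (R : realFieldType) (a d l : R).
Hypothesis params : [/\ 9 <= a, 0 < d & a * d <= 1].
Hypothesis level_params : [/\ (55 / 322) * (a - 377 / 144) <= l, 27 / 25 <= l &
   (a * d + 55 / 144 * a - 377 / 144 * d - 1) * (72 / 161) <= l].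

Lemma d_le_inv9 : d <= 1 / 9.
Proof. case: params => ha hd0 had; nra. Qed.

(** With l replaced by its linear lower bound in a, the tightest point is t = 1/2, a = 9, where the
    sides are 3.25 and about 3.27. *)
Lemma parabola (t : R) : 0 <= t -> t <= 1 / 2 ->
  t * (a - 2 - t) <= l * (2 + 2 * t).
Proof.
case: params => ha hd0 had; case: level_params => h1 _ _.
move=> t0 t1.
apply: le_trans (_ : (55 / 322) * (a - 377 / 144) * (2 + 2 * t) <= _); last first.
  by rewrite ler_pM2r; lra.
have h4 : 0 <= (a - 9) * (1 / 2 - t) by apply: mulr_ge0; lra.
nra.
Qed.

Lemma parabola_sub (t r x y : R) : 0 <= t -> t <= 1 / 2 -> t <= r -> x <= t ->
  0 <= x -> y <= a - 2 - r -> x * y <= l * (2 + t + r).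
Proof.
case: params => ha hd0 had; case: level_params => _ h2 _.
move=> t0 t1 tr xt x0 yr.
apply: (@le_trans _ _ (t * (a - 2 - t))).
  apply: (@le_trans _ _ (x * (a - 2 - t))); first by rewrite ler_wpM2l //; lra.
  by rewrite ler_wpM2r //; lra.
apply: le_trans (parabola t0 t1) _.
by rewrite ler_pM2l; lra.
Qed.

Lemma level_bound_shift2 (x r : R) : 2 <= x -> x - 2 <= 1 / 2 -> x - 2 <= r -> r <= 1 ->
  `|x - (2 + d)| * `|2 - a + r| <= l * (x + r).
Proof.
case: params => ha hd0 had; case: level_params => _ h2 _.
move=> x2 x1 xr r1; have h4 := d_le_inv9.
rewrite (ler0_norm (_ : 2 - a + r <= 0)); last by lra.
have [h|h] := leP d (x - 2).
  rewrite ger0_norm; last by lra.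
  rewrite (_ : x + r = 2 + (x - 2) + r); last by ring.
  by apply: parabola_sub; lra.
rewrite ltr0_norm; last by lra.
have h5 : - (x - (2 + d)) * - (2 - a + r) <= d * a by apply: ler_pM; lra.
have h6 : 2 * (27 / 25) <= (x + r) * l by apply: ler_pM; lra.
lra.
Qed.

Lemma level_bound_shift0 (x r : R) : d <= r -> r <= 1 / 2 -> 2 + r <= x ->
  `|x - a| * `|- d + r| <= l * (x + r).
Proof.
case: params => ha hd0 had; case: level_params => _ h2 _.
move=> dr r1 xr; have h4 := d_le_inv9.
rewrite (ger0_norm (_ : 0 <= - d + r)); last by lra.
have [h|h] := leP x a.
  rewrite ler0_norm; last by lra.
  rewrite mulrC; apply: le_trans (_ : l * (2 + r + r) <= _).
    by apply: parabola_sub; lra.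
  by rewrite ler_pM2l; lra.
rewrite gtr0_norm; last by lra.
rewrite mulrC [leRHS]mulrC [leRHS]mulrC; by apply: ler_pM; lra.
Qed.

Lemma level_bound_reflect (x r : R) : 0 <= r -> r <= d + 1 / 100 -> 2 <= x ->
  `|x + a| * `|d + r| <= l * (x + r).
Proof.
case: params => ha hd0 had; case: level_params => _ h2 h3.
move=> r0 r1 x2; have h4 := d_le_inv9.
rewrite !ger0_norm; [|lra|lra].
have h5 : (x + a) * (d + r) <= (x + a) * (2 * d + 1 / 100) by rewrite ler_pM2l; lra.
have h6 : l * x <= l * (x + r) by rewrite ler_pM2l; lra.
have h7 : 0 <= (l - 2 * d - 1 / 100) * (x - 2) by apply: mulr_ge0; lra.
have ad0 : 0 <= a * d by apply: mulr_ge0; lra.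
nra.
Qed.

Lemma level_bound_shift1 (x r : R) : 1 / 2 <= r -> r <= 1 -> 5 / 2 <= x ->
  `|x - (a - 1)| * `|- d - 1 + r| <= l * (x + r).
Proof.
case: params => ha hd0 had; case: level_params => _ h2 h3.
move=> r0 r1 x2; have h4 := d_le_inv9.
have ad0 : 0 <= a * d by apply: mulr_ge0; lra.
rewrite (ler0_norm (_ : - d - 1 + r <= 0)); last by lra.
have [h|h] := leP x (a - 1).
  rewrite ler0_norm; last by lra.
  have h5 : - (x - (a - 1)) * - (- d - 1 + r) <= (a - 7 / 2) * (1 / 2 + d).
    by apply: ler_pM; lra.
  have h6 : l * 3 <= l * (x + r) by rewrite ler_pM2l; lra.
  lra.
rewrite gtr0_norm; last by lra.
by rewrite [leRHS]mulrC; apply: ler_pM; lra.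
Qed.

(** The strip x >= 2, 0 <= r <= 1 is covered by four regions: -a serves for r up to just above d, a
    + 2 - u = 2 + d for x - 2 <= min (1/2, r), then a for r <= 1/2 and a - 1 for r > 1/2. The last
    conclusion keeps t and t' away from -r, the preimage of infinity, so that the transported
    conjugates become close. *)
Lemma exists_image_below_level (u : int) (x r : R) :
  a = u%:~R + d -> 2 <= x -> 0 <= r -> r <= 1 ->
  exists m n : int, [/\ m ^+ 2 = 1,
    `|x - (m%:~R * a + n%:~R)| * `|m%:~R * - d + n%:~R + r| <= l * (x + r) &
    d / 2 <= `|m%:~R * a + n%:~R + r| * `|m%:~R * - d + n%:~R + r| ].
Proof.
case: params => ha hd0 had; move=> E x2 r0 r1; have h4 := d_le_inv9.
(* The margin 1/100 serves the choice t = a below: (a + r) (r - d) >= 9/100, while d / 2 <= 1/18. *)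
have [rd|rd] := leP r (d + 1 / 100).
  exists (-1), 0; split=> //.
    rewrite (_ : x - _ = x + a); last by ring.
    rewrite (_ : _ * - d + _ + r = d + r); last by ring.
    exact: level_bound_reflect.
  rewrite (_ : _ * - d + _ + r = d + r); last by ring.
  rewrite (_ : _ * a + _ + r = r - a); last by ring.
  rewrite ler0_norm; last by lra.
  rewrite gtr0_norm; last by lra.
  nra.
have [/andP[x1 xr]|xr] := boolP ((x - 2 <= 1 / 2) && (x - 2 <= r)).
  exists 1, (2 - u); split=> //.
    rewrite (_ : x - _ = x - (2 + d)); last by rewrite E; ring.
    rewrite (_ : _ * - d + _ + r = 2 - a + r); last by rewrite E; ring.
    exact: level_bound_shift2.
  rewrite (_ : _ * - d + _ + r = 2 - a + r); last by rewrite E; ring.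
  rewrite (_ : _ * a + _ + r = 2 + d + r); last by rewrite E; ring.
  rewrite ger0_norm; last by lra.
  rewrite ltr0_norm; last by lra.
  nra.
have {}xr : 1 / 2 < x - 2 \/ r < x - 2.
  by move: xr; rewrite negb_and -!ltNge => /orP.
have [r2|r2] := leP r (1 / 2).
  exists 1, 0; split=> //.
    rewrite (_ : x - _ = x - a); last by ring.
    rewrite (_ : _ * - d + _ + r = - d + r); last by ring.
    apply: level_bound_shift0; lra.
  rewrite (_ : _ * - d + _ + r = - d + r); last by ring.
  rewrite (_ : _ * a + _ + r = a + r); last by ring.
  rewrite !ger0_norm; [nra|lra|lra].
exists 1, (-1); split=> //.
  rewrite (_ : x - _ = x - (a - 1)); last by ring.
  rewrite (_ : _ * - d + _ + r = - d - 1 + r); last by ring.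
  apply: level_bound_shift1; lra.
rewrite (_ : _ * - d + _ + r = - d - 1 + r); last by ring.
rewrite (_ : _ * a + _ + r = a - 1 + r); last by ring.
rewrite ger0_norm; last by lra.
rewrite ler0_norm; last by lra.
nra.
Qed.

End LevelBounds.

(** * Galois conjugation on the orbit *)

Section Rational.
Variable R : realType.
Implicit Types x y : R.

Lemma rational_int (n : int) : rational (n%:~R : R).
Proof. by exists n%:~R => //; rewrite ratr_int. Qed.

Lemma rationalD x y : rational x -> rational y -> rational (x + y).
Proof. by move=> [q _ <-] [r _ <-]; exists (q + r) => //; rewrite rmorphD. Qed.

Lemma rationalN x : rational x -> rational (- x).
Proof. by move=> [q _ <-]; exists (- q) => //; rewrite rmorphN. Qed.

Lemma rationalB x y : rational x -> rational y -> rational (x - y).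
Proof. by move=> hx hy; apply: rationalD => //; apply: rationalN. Qed.

Lemma rationalM x y : rational x -> rational y -> rational (x * y).
Proof. by move=> [q _ <-] [r _ <-]; exists (q * r) => //; rewrite rmorphM. Qed.

Lemma rationalV x : rational x -> rational x^-1.
Proof. by move=> [q _ <-]; exists q^-1 => //; rewrite fmorphV. Qed.

Lemma linear_irrational x y z : ~ rational x -> rational y -> rational z ->
  y * x = z -> y = 0.
Proof.
move=> nx hy hz e; apply/eqP/negPn/negP => y0; apply: nx.
have -> : x = y^-1 * z by rewrite -e mulrA mulVf // mul1r.
by apply: rationalM => //; apply: rationalV.
Qed.

(** The quadratic with roots x and y has no rational root, hence is irreducible. Conversely, if z is
    a conjugate of x, then y - z and (y - z) x are rational, which forces y = z. *)
Lemma galois_conj_quadratic x y : ~ rational x -> rational (x + y) ->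
  rational (x * y) -> galois_conj x = y.
Proof.
move=> nx [s _ hs] [p _ hp]; apply: xget_unique => [|z].
  pose P : {poly rat} := 'X^2 - s *: 'X + p%:P.
  have PE : map_poly (ratr : rat -> R) P = ('X - x%:P) * ('X - y%:P).
    rewrite /P rmorphD rmorphB /= map_polyZ map_polyXn map_polyX map_polyC /= hs hp.
    rewrite -mul_polyC polyCD.
    have -> : (x * y)%:P = x%:P * y%:P by rewrite polyCM.
    ring.
  exists P; split=> //; apply: cubic_irreducible.
    rewrite -(size_map_poly (ratr : {rmorphism rat -> R})) PE.
    by rewrite size_Mmonic ?polyXsubC_eq0 ?monicXsubC // !size_XsubC.
  move=> q; apply/negP => /rootP hq.
  have : (map_poly (ratr : rat -> R) P).[ratr q] = 0 by rewrite horner_map hq rmorph0.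
  rewrite PE hornerM !hornerXsubC => /eqP; rewrite mulf_eq0 !subr_eq0 => /orP[/eqP e|/eqP e].
    by apply: nx; exists q.
  apply: nx; exists (s - q) => //; rewrite rmorphB /= hs e; ring.
move=> [P [_ PE]].
(* The values of P at 0 and 1 give the rationality of x z and x + z. *)
have ev (q : rat) : rational ((ratr q - x) * (ratr q - z) : R).
  exists P.[q] => //.
  by rewrite -(horner_map (ratr : {rmorphism rat -> R})) PE hornerM !hornerXsubC.
have xz : rational (x * z).
  by have := ev 0; rewrite rmorph0 !sub0r mulrNN.
have sxz : rational (x + z).
  have -> : x + z = 1 + x * z - (ratr 1 - x) * (ratr 1 - z) by rewrite rmorph1; ring.
  by apply: rationalB (ev 1); apply: rationalD => //; exact: (rational_int 1).
apply/esym/eqP; rewrite -subr_eq0; apply/eqP.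
apply: (@linear_irrational x _ (x * y - x * z)) => //; last by ring.
  rewrite (_ : y - z = x + y - (x + z)); last by ring.
  by apply: rationalB => //; exists s.
by apply: rationalB => //; exists p.
Qed.

End Rational.

Section Orbit.
Variables (R : realType) (a d : R) (u v : int).
Hypotheses (aE : a - d = u%:~R) (adE : v%:~R * (a * d) = u%:~R).
Hypotheses (v0 : v != 0) (na : ~ rational a).

Let nd : ~ rational (- d).
Proof.
have -> : - d = u%:~R - a by rewrite -aE; ring.
move=> h; apply: na; rewrite (_ : a = u%:~R - (u%:~R - a)); last by ring.
by apply: rationalB => //; apply: rational_int.
Qed.

Let rational_ad : rational (a * d).
Proof.
have vR : (v%:~R : R) != 0 by rewrite intr_eq0.
have -> : a * d = u%:~R / v%:~R by rewrite -adE mulrAC divff // mul1r.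
by apply: rationalM; [|apply: rationalV]; apply: rational_int.
Qed.

Lemma linear_neq0 (e f : int) (z : R) : ~ rational z -> (e != 0) || (f != 0) ->
  e%:~R * z + f%:~R != 0.
Proof.
move=> nz ef; apply/eqP => h.
have e0 : (e%:~R : R) = 0.
  apply: (linear_irrational nz (rational_int _ e) (rationalN (rational_int _ f))).
  by apply/eqP; rewrite -subr_eq0 opprK h.
move: h; rewrite e0 mul0r add0r => /eqP; rewrite intr_eq0 => /eqP f0.
by move: ef; rewrite f0 eqxx orbF => /negP; apply; rewrite -(intr_eq0 R) e0.
Qed.

Definition lft (p q e f : int) (z : R) := (p%:~R * z + q%:~R) / (e%:~R * z + f%:~R).

Lemma lft_den_neq0 (p q e f : int) (z : R) : (p * f - q * e) ^+ 2 = 1 ->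
  ~ rational z -> e%:~R * z + f%:~R != 0.
Proof.
move=> h nz; apply: linear_neq0 => //; apply/negPn/negP.
rewrite negb_or !negbK => /andP[/eqP e0 /eqP f0].
by move: h; rewrite e0 f0 !mulr0 subr0 expr0n.
Qed.

(** If the value b were rational, (p - b e) z = b f - q would give p = b e and q = b f, hence
    determinant 0. *)
Lemma lft_irrational (p q e f : int) (z : R) : (p * f - q * e) ^+ 2 = 1 ->
  ~ rational z -> ~ rational (lft p q e f z).
Proof.
move=> h nz hb; have D0 := lft_den_neq0 h nz.
have e1 : (p%:~R - lft p q e f z * e%:~R) * z = lft p q e f z * f%:~R - q%:~R.
  apply/eqP; rewrite -subr_eq0; apply/eqP.
  rewrite (_ : _ - _ = p%:~R * z + q%:~R - lft p q e f z * (e%:~R * z + f%:~R)); last by ring.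
  by rewrite /lft divfK // subrr.
have Z := rational_int R.
have e2 := linear_irrational nz (rationalB (Z p) (rationalM hb (Z e)))
  (rationalB (rationalM hb (Z f)) (Z q)) e1.
move: e1; rewrite e2 mul0r => /esym e3.
have : ((p * f - q * e)%:~R : R) = 0.
  rewrite rmorphB !rmorphM /=.
  have -> : (p%:~R : R) = lft p q e f z * e%:~R by apply/eqP; rewrite -subr_eq0 e2.
  have -> : (q%:~R : R) = lft p q e f z * f%:~R by apply/eqP; rewrite eq_sym -subr_eq0 e3.
  by ring.
by move/eqP; rewrite intr_eq0 => /eqP E; move: h; rewrite E expr0n.
Qed.

Lemma galois_conj_lft (p q e f : int) : (p * f - q * e) ^+ 2 = 1 ->
  galois_conj (lft p q e f a) = lft p q e f (- d).
Proof.
move=> h; have D1 := lft_den_neq0 h na; have D2 := lft_den_neq0 h nd.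
have Z := rational_int R.
(* [M p q] is the norm of p a + q, in a visibly rational form. *)
pose M (p q : int) : R := (p ^+ 2)%:~R * - (a * d) + (p * q)%:~R * u%:~R + (q ^+ 2)%:~R.
have ratM p' q' : rational (M p' q').
  by apply: rationalD => //; apply: rationalD; apply: rationalM => //; apply: rationalN.
have ME p' q' : M p' q' = (p'%:~R * a + q'%:~R) * (p'%:~R * - d + q'%:~R).
  by rewrite /M -aE; ring.
apply: galois_conj_quadratic; first exact: lft_irrational.
  have -> : lft p q e f a + lft p q e f (- d) =
    ((p * e)%:~R * - (a * d) *+ 2 + (p * f + q * e)%:~R * u%:~R + (q * f)%:~R *+ 2) / M e f.
    rewrite ME /lft -aE; field; exact/andP.
  apply: rationalM; last exact: rationalV.
  rewrite !mulr2n.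
  have hN n : rational (n%:~R * - (a * d)) by apply: rationalM (Z n) (rationalN _).
  by do !apply: rationalD => //; apply: rationalM.
have -> : lft p q e f a * lft p q e f (- d) = M p q / M e f.
  rewrite !ME /lft; field; exact/andP.
by apply: rationalM; last exact: rationalV.
Qed.

Lemma galois_conj_self : galois_conj a = - d.
Proof.
have := @galois_conj_lft 1 0 0 1 erefl.
by rewrite /lft !mul1r !mul0r !addr0 !add0r !divr1.
Qed.

Lemma mobiusE (M : 'M[int]_2) (z : R) : mobius M z = lft (M 0 0) (M 0 1) (M 1 0) (M 1 1) z.
Proof. by []. Qed.

Lemma det_mx22 (M : 'M[int]_2) : \det M = M 0 0 * M 1 1 - M 0 1 * M 1 0.
Proof.
rewrite (expand_det_row _ 0) !big_ord_recl big_ord0 /cofactor !det_mx11 !mxE /=.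
rewrite /= expr0 expr1 addr0 mul1r mulN1r mulrN.
by congr (M _ _ * M _ _ - M _ _ * M _ _); apply/val_inj.
Qed.

Lemma lft_flip (p q e f : int) :
  lft p q e f (- d) = lft (- p) (q + p * u) (- e) (f + e * u) a.
Proof. by rewrite /lft; congr (_ / _); rewrite rmorphD rmorphM rmorphN /= -aE; ring. Qed.

Lemma ThetaP (b : R) : Theta a b <->
  exists p q e f : int, (p * f - q * e) ^+ 2 = 1 /\ b = lft p q e f a.
Proof.
split.
  move=> [M [detM]]; rewrite galois_conj_self !mobiusE; rewrite det_mx22 in detM => -[->|->].
    by exists (M 0 0), (M 0 1), (M 1 0), (M 1 1); rewrite detM.
  exists (- M 0 0), (M 0 1 + M 0 0 * u), (- M 1 0), (M 1 1 + M 1 0 * u); split.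
    rewrite (_ : _ - _ = - (M 0 0 * M 1 1 - M 0 1 * M 1 0)); last by ring.
    by rewrite detM.
  exact: lft_flip.
move=> [p [q [e [f [h ->]]]]].
have [D|D] : p * f - q * e = 1 \/ p * f - q * e = -1.
- by move/eqP: h; rewrite sqrf_eq1 => /orP[]/eqP ->; [left|right].
- exists (\matrix_(i, j) if i == 0 then if j == 0 then p else q else if j == 0 then e else f).
  by rewrite det_mx22 !mobiusE !mxE /=; split => //; left.
- exists (\matrix_(i, j) if i == 0 then if j == 0 then - p else q + p * u
                         else if j == 0 then - e else f + e * u).
  rewrite det_mx22 !mobiusE !mxE /=; split; first by rewrite -[RHS]opprK -D; ring.
  right; rewrite galois_conj_self lft_flip.
  by congr lft; ring.
Qed.

End Orbit.

(** * Distances to the golden ratio and its conjugate *)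

Lemma normr_sqr1 (R : realType) (n : int) : n ^+ 2 = 1 -> `|n%:~R : R| = 1.
Proof. by move/eqP; rewrite sqrf_eq1 => /orP[]/eqP->; rewrite ?rmorphN normrE ?normr1. Qed.

Lemma lft_dist (R : realType) (p q e f : int) (x y : R) : (p * f - q * e) ^+ 2 = 1 ->
  e%:~R * x + f%:~R != 0 -> e%:~R * y + f%:~R != 0 ->
  `|lft p q e f x - lft p q e f y| =
  `|x - y| / (`|e%:~R * x + f%:~R| * `|e%:~R * y + f%:~R|).
Proof.
move=> h hx hy.
have -> : lft p q e f x - lft p q e f y =
  (p * f - q * e)%:~R * (x - y) / ((e%:~R * x + f%:~R) * (e%:~R * y + f%:~R)).
  by rewrite /lft rmorphB !rmorphM /=; field; apply/andP.
by rewrite normrM normfV !normrM normr_sqr1 // mul1r.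
Qed.

Section Lower.
Variables (R : realType) (a d s : R) (u v : int).
Hypotheses (hu : 9 <= u) (huv : u <= v).
Hypotheses (aE : a - d = u%:~R) (adE : v%:~R * (a * d) = u%:~R).
Hypotheses (ad0 : 0 < a + d) (s0 : 0 < s) (ss : s * s = 5).

(* The coefficients are those of the form (p X + q)^2 - (p X + q) (e X + f) -
   (e X + f)^2, whose roots are the preimages of (1 +- sqrt 5) / 2. *)
Definition golden_form (p q e f : int) :=
  pairing u v (p ^+ 2 - p * e - e ^+ 2) (2 * p * q - (p * f + q * e) - 2 * e * f)
    (q ^+ 2 - q * f - f ^+ 2).

(** Changing the sign of s exchanges the golden ratio with its conjugate. The part of the product
    even in s is the integer [golden_form]; the odd part is the determinant times s v (a + d). *)
Lemma golden_form_identity (p q e f : int) :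
  2 * v%:~R * (((p%:~R * a + q%:~R) - (1 + s) / 2 * (e%:~R * a + f%:~R)) *
   ((p%:~R * - d + q%:~R) - (1 - s) / 2 * (e%:~R * - d + f%:~R)))
  = (golden_form p q e f)%:~R + (p * f - q * e)%:~R * (s * (v%:~R * (a + d))).
Proof.
have -> : (golden_form p q e f)%:~R =
   (a - d) * v%:~R * (2 * p * q - (p * f + q * e) - 2 * e * f)%:~R
   + 2 * v%:~R * (q ^+ 2 - q * f - f ^+ 2)%:~R
   - 2 * (v%:~R * (a * d)) * (p ^+ 2 - p * e - e ^+ 2)%:~R :> R.
  by rewrite aE adE /golden_form /pairing; ring.
(* Adding a multiple of this zero lets [field] use s^2 = 5; the same device recurs below. *)
have k0 : (1 - s * s) / 4 + 1 = 0 by rewrite ss; field.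
rewrite -[RHS]addr0 -(mulr0 (2 * v%:~R * (e%:~R * a + f%:~R) * (e%:~R * - d + f%:~R))) -k0.
by field.
Qed.

(** Up to the factor 2 v s, [level] is the distance from s v (a + d) to the upper end of the gap of
    [gap_pairing]. *)
Lemma level_v : 2 * (v%:~R * (s * level a d s)) =
  3 * u%:~R * v%:~R - 2 * v%:~R + 2 * u%:~R - s * (v%:~R * (a + d)).
Proof.
have sn0 : s != 0 by rewrite gt_eqF.
have -> : s * level a d s = (a - (3 + s) / 2) * (d + (3 - s) / 2).
  by rewrite /level mulrCA divff // mulr1.
rewrite -{2}adE -aE.
have k0 : (1 - s * s) / 4 + 1 = 0 by rewrite ss; field.
rewrite -[RHS]addr0 -(mulr0 (- (2 * v%:~R))) -k0.
by field.
Qed.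

(** The left side is the midpoint of the gap, so of its two ends the upper one is nearer to s v (a +
    d). *)
Lemma disc_ge : 2 * u%:~R * v%:~R + 2 * u%:~R <= s * (v%:~R * (a + d)).
Proof.
have uv : 4 * (u * v + u) ^+ 2 <= 5 * (u ^+ 2 * v ^+ 2 + 4 * u * v).
  have h1 : 9 * u ^+ 2 * v <= u ^+ 2 * v ^+ 2.
    by have := mulr_ge0 (_ : 0 <= u ^+ 2 * v) (_ : 0 <= v - 9); nia.
  nia.
have v0 : 0 < v%:~R :> R by rewrite ltr0z; lia.
rewrite -(@ler_pXn2r _ 2) // ?nnegrE; first last.
- by apply: mulr_ge0; [exact: ltW|apply: mulr_ge0; exact: ltW].
- by rewrite addr_ge0 ?mulr_ge0 ?(ltW v0) ?ler0z //; lia.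
(* v (a + d) is the square root of the discriminant of v X^2 - u v X - u. *)
have -> : (s * (v%:~R * (a + d))) ^+ 2 = (5 * (u ^+ 2 * v ^+ 2 + 4 * u * v))%:~R.
  rewrite exprMn expr2 ss.
  rewrite (_ : (v%:~R * (a + d)) ^+ 2 = (v%:~R * (a - d)) ^+ 2 + 4 * v%:~R * (v%:~R * (a * d))).
    rewrite aE adE; ring.
  ring.
rewrite (_ : (_ + _) ^+ 2 = (4 * (u * v + u) ^+ 2)%:~R); last by ring.
by rewrite ler_int.
Qed.

Lemma golden_form_ge (p q e f : int) : (p * f - q * e) ^+ 2 = 1 ->
  s * level a d s <=
  `|(p%:~R * a + q%:~R) - (1 + s) / 2 * (e%:~R * a + f%:~R)| *
  `|(p%:~R * - d + q%:~R) - (1 - s) / 2 * (e%:~R * - d + f%:~R)|.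
Proof.
move=> h.
have v0 : 0 < v%:~R :> R by rewrite ltr0z; lia.
rewrite -(ler_pM2l v0) -(@ler_pM2l _ 2) // level_v -normrM.
have nE x : 2 * (v%:~R * `|x|) = `|2 * v%:~R * x| :> R.
  by rewrite !normrM (gtr0_norm v0) ger0_norm // mulrA.
rewrite nE golden_form_identity.
have : gap u v (golden_form p q e f).
  apply: gap_pairing => //.
  rewrite -[RHS](_ : 5 * (p * f - q * e) ^+ 2 = 5); [ring|by rewrite h].
have D := disc_ge.
set t := s * _ in D *.
have t0 : 0 <= t by apply: mulr_ge0; [exact: ltW|apply: mulr_ge0; exact: ltW].
have et : `|(p * f - q * e)%:~R * t| = t.
  by rewrite normrM normr_sqr1 // mul1r ger0_norm.
have u0 : 9 <= u%:~R :> R by rewrite (ler_int _ 9).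
case=> g.
  have {}g : `|(golden_form p q e f)%:~R| <= u%:~R * v%:~R + 2 * u%:~R + 2 * v%:~R :> R.
    by rewrite -intr_norm; rewrite -(ler_int R) in g; move: g; rewrite !(rmorphD, rmorphM).
  have := lerB_dist ((p * f - q * e)%:~R * t) (- (golden_form p q e f)%:~R).
  rewrite opprK normrN et => D2.
  rewrite [X in _ <= `|X|]addrC; lra.
have {}g : 3 * u%:~R * v%:~R - 2 * v%:~R + 2 * u%:~R <= `|(golden_form p q e f)%:~R| :> R.
  by rewrite -intr_norm; rewrite -(ler_int R) in g; move: g; rewrite !(rmorphD, rmorphN, rmorphM).
have := lerB_dist (golden_form p q e f)%:~R (- ((p * f - q * e)%:~R * t)).
rewrite opprK normrN et => D2.
lra.
Qed.

End Lower.

(** For X = |phi - b| and r = |b - b^sigma|, the factor s + X + r bounds the distance of the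
    conjugates. Were 2 X < (K - eps) r, this factor would be at most s + (K / 2 + 1) r, and eps
    absorbs the excess when r is small. *)
Lemma cross_ratio_lower (R : realFieldType) (K s r X eps : R) :
  0 < K -> 0 < s -> 0 < r -> 0 <= X -> 0 < eps -> r * (K * (K / 2 + 1)) < eps * s ->
  K * s * r <= 2 * X * (s + X + r) -> (K - eps) * r <= 2 * X.
Proof.
move=> K0 s0 r0 X0 eps0 re hXY; rewrite leNgt; apply/negP => h.
have Ke : 0 < K - eps.
  by rewrite -(pmulr_lgt0 _ r0); apply: le_lt_trans h; rewrite mulr_ge0.
have er : 0 < eps * r by exact: mulr_gt0.
have h2 : 2 * X <= K * r by lra.
have h3 : 2 * X * (s + X + r) <= (K - eps) * r * (s + (K / 2 + 1) * r).
  by apply: ler_pM; lra.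
have h4 : K * s <= (K - eps) * (s + (K / 2 + 1) * r).
  by rewrite -(ler_pM2r r0); apply: le_trans hXY (le_trans h3 _); rewrite mulrAC.
have h5 : 0 <= eps * ((K / 2 + 1) * r).
  by rewrite mulr_ge0 ?mulr_ge0 ?addr_ge0 ?divr_ge0 // ltW.
lra.
Qed.

(** * Approximations of xi obtained from its complete quotients *)

Section Point.
Variables (R : realType) (a d : R) (u v : int).
Hypotheses (aE : a - d = u%:~R) (adE : v%:~R * (a * d) = u%:~R) (v0 : v != 0).
Hypotheses (na : ~ rational a) (ad0 : 0 < a + d).

(** Since e z + f = e (z + r), all powers of e cancel in the quotient of the two distances, while |b
    - b^sigma| is (a + d) / (e^2 |t + r| |t' + r|). The lower bound d / 2 makes this tend to 0 as e
    grows. *)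
Lemma lft_point (xi x c : R) (p q e f m n : int) :
  (p * f - q * e) ^+ 2 = 1 -> m ^+ 2 = 1 -> 1 <= e -> 0 <= f -> 1 < x -> 0 < d ->
  xi = lft p q e f x ->
  let r := f%:~R / e%:~R in
  `|x - (m%:~R * a + n%:~R)| * `|m%:~R * - d + n%:~R + r| <= c * (x + r) ->
  d / 2 <= `|m%:~R * a + n%:~R + r| * `|m%:~R * - d + n%:~R + r| ->
  exists b, [/\ Theta a b, `|b - galois_conj b| <= 2 * (a + d) / d / e%:~R &
    2 * (`|xi - b| / `|b - galois_conj b|) <= 2 * c / (a + d)].
Proof.
move=> h hm e1 f0 x1 d0 -> r.
set T := m%:~R * a + n%:~R; set T' := m%:~R * - d + n%:~R => hc hd.
have e0 : 0 < e%:~R :> R by rewrite ltr0z; lia.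
have eR : 1 <= e%:~R :> R by rewrite ler1z.
have r0 : 0 <= r by rewrite divr_ge0 ?ler0z //; lia.
have nd : ~ rational (- d).
  move=> hd'; apply: na; rewrite (_ : a = u%:~R + - - d); last by rewrite opprK -aE; ring.
  by apply: rationalD; [exact: rational_int|exact: rationalN].
have comp z : lft (p * m) (p * n + q) (e * m) (e * n + f) z =
    lft p q e f (m%:~R * z + n%:~R).
  by rewrite /lft; congr (_ / _); ring.
have h' : (p * m * (e * n + f) - (p * n + q) * (e * m)) ^+ 2 = 1.
  by rewrite (_ : _ - _ = m * (p * f - q * e)) ?exprMn ?hm ?h //; ring.
have D1 := lft_den_neq0 h' na; have D2 := lft_den_neq0 h' nd.
rewrite (_ : _ + _ = e%:~R * T + f%:~R) in D1; last by rewrite /T; ring.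
rewrite (_ : _ + _ = e%:~R * T' + f%:~R) in D2; last by rewrite /T'; ring.
have E z : e%:~R * z + f%:~R = e%:~R * (z + r) by rewrite mulrDr mulrCA divff ?mulr1 // gt_eqF.
exists (lft p q e f T); rewrite -comp (galois_conj_lft aE adE v0 na h') !comp -/T -/T'.
have D3 : e%:~R * x + f%:~R != 0 by rewrite E mulf_neq0 // gt_eqF //; lra.
have TT : `|T - T'| = a + d.
  rewrite (_ : T - T' = m%:~R * (a + d)) ?normrM ?normr_sqr1 ?mul1r ?(gtr0_norm ad0) //.
  by rewrite /T /T'; ring.
rewrite !lft_dist // TT.
split.
- apply/(ThetaP aE adE v0 na); exists (p * m), (p * n + q), (e * m), (e * n + f).
  by split; rewrite // comp.
- rewrite !E !normrM (gtr0_norm e0) mulrACA.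
  rewrite (_ : 2 * (a + d) / d / e%:~R = (a + d) / (e%:~R * (d / 2))); last first.
    by field; rewrite !gt_eqF.
  rewrite ler_pM2l // lef_pV2 ?posrE; first last.
  + by rewrite mulr_gt0 ?divr_gt0.
  + by apply: mulr_gt0; [exact: mulr_gt0|apply: lt_le_trans hd; exact: divr_gt0].
  apply: ler_pM => //; [exact: ltW|by rewrite divr_ge0 // ltW|].
  by rewrite ler_peMl // ltW.
- have xr : 0 < x + r by lra.
  rewrite !E in D1 D2 *.
  move: D1 D2; rewrite !mulf_eq0 !negb_or gt_eqF //= => t1 t2.
  rewrite !normrM (gtr0_norm e0) (gtr0_norm xr).
  have -> : 2 * (`|x - T| / (e%:~R * (x + r) * (e%:~R * `|T + r|)) /
     ((a + d) / (e%:~R * `|T + r| * (e%:~R * `|T' + r|)))) =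
     2 / (a + d) * (`|x - T| * `|T' + r| / (x + r)).
    by field; rewrite !normr_eq0 t1 t2 !gt_eqF.
  rewrite [leRHS](_ : _ = 2 / (a + d) * c); last by rewrite mulrAC.
  by rewrite ler_pM2l ?divr_gt0 // ler_pdivrMr.
Qed.

End Point.

(** * The lower bound at the golden ratio *)

Section GoldenLower.
Variables (R : realType) (a d s : R) (u v : int).
Hypotheses (hu : 9 <= u) (huv : u <= v).
Hypotheses (aE : a - d = u%:~R) (adE : v%:~R * (a * d) = u%:~R).
Hypotheses (na : ~ rational a) (s0 : 0 < s) (ss : s * s = 5).
Hypotheses (ad0 : 0 < a + d) (l0 : 0 < level a d s).

Let v0 : v != 0. Proof. by apply/eqP; lia. Qed.

(** Otherwise the first factor in [golden_form_ge] would vanish. *)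
Lemma golden_notin_Theta : ~ Theta a ((1 + s) / 2).
Proof.
move/(ThetaP aE adE v0 na) => [p [q [e [f [h E]]]]].
have D := lft_den_neq0 h na.
have := golden_form_ge hu huv aE adE ad0 s0 ss h.
rewrite E /lft divfK // subrr normr0 mul0r leNgt => /negP; apply.
exact: mulr_gt0.
Qed.

Lemma Theta_product (b : R) : Theta a b ->
  0 < `|b - galois_conj b| /\
  s * level a d s / (a + d) * `|b - galois_conj b| <=
  `|(1 + s) / 2 - b| * `|(1 - s) / 2 - galois_conj b|.
Proof.
move/(ThetaP aE adE v0 na) => [p [q [e [f [h ->]]]]].
rewrite (galois_conj_lft aE adE v0 na h).
have nd : ~ rational (- d).
  move=> hd; apply: na; rewrite (_ : a = u%:~R + - - d); last by rewrite opprK -aE; ring.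
  by apply: rationalD; [exact: rational_int|exact: rationalN].
have D1 := lft_den_neq0 h na; have D2 := lft_den_neq0 h nd.
rewrite lft_dist // opprK (gtr0_norm ad0).
have := golden_form_ge hu huv aE adE ad0 s0 ss h.
set A := e%:~R * a + f%:~R in D1 *; set B := e%:~R * - d + f%:~R in D2 *.
move=> fg; split; first by rewrite divr_gt0 // mulr_gt0 // normr_gt0.
have -> : (1 + s) / 2 - lft p q e f a = - (p%:~R * a + q%:~R - (1 + s) / 2 * A) / A.
  by rewrite /lft -/A; field; exact: D1.
have -> : (1 - s) / 2 - lft p q e f (- d) = - (p%:~R * - d + q%:~R - (1 - s) / 2 * B) / B.
  by rewrite /lft -/B; field; exact: D2.
rewrite !normrM !normrN !normfV [leRHS]mulrACA -invfM [leLHS]mulrA.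
rewrite ler_pM2r ?invr_gt0 ?mulr_gt0 ?normr_gt0 //.
by rewrite divfK // gt_eqF.
Qed.

Lemma golden_lower (eps : R) : 0 < eps -> exists2 e : R, 0 < e &
  forall b, Theta a b -> `|b - galois_conj b| < e ->
  2 * level a d s / (a + d) - eps <= 2 * (`|(1 + s) / 2 - b| / `|b - galois_conj b|).
Proof.
move=> eps0; set K := 2 * level a d s / (a + d).
have K0 : 0 < K by rewrite divr_gt0 // mulr_gt0.
have K1 : 0 < K * (K / 2 + 1) by rewrite mulr_gt0 // addr_gt0 // divr_gt0.
(* This is the bound on r required by [cross_ratio_lower]. *)
exists (eps * s / (K * (K / 2 + 1))); first by rewrite divr_gt0 // mulr_gt0.
move=> b /Theta_product[]; set r := `|b - _|; set X := `|_ - b|; set Y := `|_ - galois_conj b|.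
move=> r0 hXY; rewrite ltr_pdivlMr // => re.
rewrite mulrA ler_pdivlMr //.
have Yle : Y <= s + X + r.
  rewrite /Y; have -> : (1 - s) / 2 - galois_conj b =
    - s + ((1 + s) / 2 - b) + (b - galois_conj b) by field.
  apply: le_trans (ler_normD _ _) _; rewrite lerD2r.
  by apply: le_trans (ler_normD _ _) _; rewrite normrN (gtr0_norm s0).
have X0 : 0 <= X by exact: normr_ge0.
have {}hXY : K * s * r <= 2 * X * (s + X + r).
  rewrite -[leRHS]mulrA; apply: le_trans (_ : 2 * (X * Y) <= _).
    rewrite -ler_pdivrMl //; apply: le_trans hXY.
    by rewrite /K le_eqVlt; apply/orP; left; apply/eqP; field; rewrite gt_eqF.
  by rewrite ler_pM2l // ler_wpM2l.
exact: cross_ratio_lower hXY.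
Qed.

End GoldenLower.

(** * Continued fractions *)

Section Expansion.
Variables (R : realType) (xi : R).

(** The intended instances: p / e and q / f are consecutive convergents of xi, starting with q / f =
    1 / 0, and x is the next complete quotient. *)
Record cf_state (p q e f : int) (x : R) : Prop := CfState {
  cf_det : (p * f - q * e) ^+ 2 = 1;
  cf_den : 1 <= e;
  cf_den_ge0 : 0 <= f;
  cf_den_le : f <= e;
  cf_tail_gt1 : 1 < x;
  cf_tail_irr : ~ rational x;
  cf_value : xi = lft p q e f x }.

Lemma cf_state_next p q e f x (n : int) : cf_state p q e f x -> 1 <= n ->
  n%:~R <= x -> x < n%:~R + 1 ->
  cf_state (p * n + q) p (e * n + f) e (x - n%:~R)^-1.
Proof.
move=> [h e1 f0 fe x1 nx E] n1 nlx xln.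
have xn : 0 < x - n%:~R.
  rewrite subr_gt0 lt_neqAle nlx andbT; apply/eqP => nE.
  by apply: nx; rewrite -nE; exact: rational_int.
have nx' : ~ rational (x - n%:~R)^-1.
  move=> hr; apply: nx; rewrite (_ : x = (x - n%:~R)^-1^-1 + n%:~R); last by rewrite invrK subrK.
  by apply: rationalD; [exact: rationalV|exact: rational_int].
have D : (e * n + f)%:~R * (x - n%:~R)^-1 + e%:~R != 0.
  rewrite gt_eqF // ltr_pwDr ?ltr0z //.
  by rewrite mulr_ge0 // ?invr_ge0 ?(ltW xn) // ler0z; nia.
split => //; [|nia|lia|nia| |].
- rewrite -h; ring.
- by rewrite -[1]invr1 ltf_pV2 ?posrE //; lra.
- have D2 := lft_den_neq0 h nx.
  rewrite E /lft !rmorphD !rmorphM /=; field.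
  rewrite gt_eqF //=.
  have -> : e%:~R * n%:~R + f%:~R + e%:~R * (x - n%:~R) = e%:~R * x + f%:~R by ring.
  by [].
Qed.

Lemma cf_state_floor p q e f x : cf_state p q e f x ->
  exists n : int, [/\ 1 <= n & cf_state (p * n + q) p (e * n + f) e (x - n%:~R)^-1].
Proof.
move=> st; have x1 := cf_tail_gt1 st.
have n1 : 1 <= Num.floor x by rewrite floor_ge_int ltW.
exists (Num.floor x); split => //; apply: cf_state_next => //.
  by rewrite -floor_ge_int.
have := floorD1_gt x; rewrite intrD; exact.
Qed.

Hypothesis nxi : ~ rational xi.

Lemma cf_state_init : exists p q e f x, cf_state p q e f x.
Proof.
set n := Num.floor xi.
have h1 : n%:~R <= xi by rewrite -floor_ge_int.
have h2 : xi < n%:~R + 1 by have := floorD1_gt xi; rewrite intrD; exact.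
have xn : 0 < xi - n%:~R.
  rewrite subr_gt0 lt_neqAle h1 andbT; apply/eqP => nE.
  by apply: nxi; rewrite -nE; exact: rational_int.
exists n, 1, 1, 0, (xi - n%:~R)^-1; split=> //.
- by rewrite mulr0 sub0r mulr1 sqrrN expr1n.
- by rewrite -[1]invr1 ltf_pV2 ?posrE //; lra.
- move=> hr; apply: nxi; rewrite (_ : xi = (xi - n%:~R)^-1^-1 + n%:~R); last by rewrite invrK subrK.
  by apply: rationalD; [exact: rationalV|exact: rational_int].
- by rewrite /lft; field; rewrite gt_eqF.
Qed.

Lemma cf_state_large (N : nat) : exists p q e f x,
  [/\ cf_state p q e f x, N%:Z <= e & 1 <= f].
Proof.
elim: N => [|N [p [q [e [f [x [st Ne f1]]]]]]].
  (* One step past the initial state f is positive; from then on each step increases e. *)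
  have [p [q [e [f [x st]]]]] := cf_state_init.
  have [n [n1 st']] := cf_state_floor st.
  do 5 eexists; split; first exact: st'; first by case: st'; lia.
  by case: st.
have [n [n1 st']] := cf_state_floor st.
do 5 eexists; split; first exact: st'; last by case: st.
by case: st; nia.
Qed.

(* Subtracting 1 and inverting repels x from phi and attracts f / e to 1 / phi;
   the factors 3 / 2 of both are only used through the linear 1 + k / 2. *)
Lemma cf_state_golden (s : R) (M : int) : 0 < s -> s * s = 5 ->
  (forall p q e f x, cf_state p q e f x -> M <= e -> x < 2) ->
  forall (k : nat) p q e f x, cf_state p q e f x -> M <= e ->
  exists p' q' e' f' x', [/\ cf_state p' q' e' f' x', M <= e',
    (1 + k%:R / 2) * `|x - (1 + s) / 2| <= `|x' - (1 + s) / 2| &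
    (1 + k%:R / 2) * `|f'%:~R / e'%:~R - (s - 1) / 2| <= 1].
Proof.
move=> s0 ss hM k p q e f x st Me.
have s2 : 2 < s by nra.
elim: k => [|k [p' [q' [e' [f' [x' [st' Me' hx hr]]]]]]].
  exists p, q, e, f, x; split => //; first by rewrite mul0r addr0 mul1r.
  have [_ e1 f0 fe _ _ _] := st.
  have e0 : 0 < e%:~R :> R by rewrite ltr0z; lia.
  have r0 : 0 <= f%:~R / e%:~R :> R by rewrite divr_ge0 // ?ler0z // ltW.
  have r1 : f%:~R / e%:~R <= 1 :> R by rewrite ler_pdivrMr // mul1r ler_int.
  have s3 : s < 3 by nra.
  by rewrite mul0r addr0 mul1r ler_norml; lra.
have x2 := hM _ _ _ _ _ st' Me'.
have [_ e1 f0 fe x1 nx' _] := st'.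
(* As 1 < x' < 2, the partial quotient is 1. *)
have st2 : cf_state (p' * 1 + q') p' (e' * 1 + f') e' (x' - 1%:~R)^-1.
  apply: cf_state_next => //; rewrite rmorph1; lra.
have e0 : 0 < e'%:~R :> R by rewrite ltr0z; lia.
have f0' : 0 <= f'%:~R :> R by rewrite ler0z.
have k0 : 0 <= k%:R :> R by [].
do 5 eexists; split; first exact: st2; first lia.
- have x3 : 0 < x' - 1 by lra.
  have -> : (x' - 1%:~R)^-1 - (1 + s) / 2 = - ((1 + s) / 2 / (x' - 1)) * (x' - (1 + s) / 2).
    rewrite -[RHS]addr0 -(mulr0 ((x' - 1)^-1)).
    rewrite -(_ : (5 - s * s) / 4 = 0); last by rewrite ss subrr mul0r.
    by field; rewrite gt_eqF.
  rewrite normrM normrN.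
  have h1 : 3 / 2 <= `|(1 + s) / 2 / (x' - 1)|.
    rewrite ger0_norm ?ler_pdivlMr ?divr_ge0 //; lra.
  have := normr_ge0 (x' - (1 + s) / 2); set X := `|x' - _| in hx *.
  have := normr_ge0 (x - (1 + s) / 2); set X0 := `|x - _| in hx *.
  move=> X00 X1.
  have h2 : 3 / 2 * X <= `|(1 + s) / 2 / (x' - 1)| * X by rewrite ler_wpM2r.
  apply: le_trans h2.
  have h3 : 0 <= k%:R * X0 by rewrite mulr_ge0.
  rewrite -natr1; lra.
- set r := f'%:~R / e'%:~R in hr.
  have r0 : 0 <= r by rewrite divr_ge0 // ltW.
  have -> : e'%:~R / (e' * 1 + f')%:~R - (s - 1) / 2 =
     - ((s - 1) / 2 / (1 + r)) * (r - (s - 1) / 2).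
    have -> : e'%:~R / (e' * 1 + f')%:~R = (1 + r)^-1.
      rewrite mulr1 rmorphD /= /r; field; rewrite ?gt_eqF //=; lra.
    rewrite -[LHS]addr0 -(mulr0 ((1 + r)^-1)).
    rewrite -(_ : (s * s - 5) / 4 = 0); last by rewrite ss subrr mul0r.
    by field; rewrite gt_eqF //; lra.
  rewrite normrM normrN.
  have s3 : s < 7 / 3 by nra.
  have h1 : `|(s - 1) / 2 / (1 + r)| <= 2 / 3.
    rewrite ger0_norm ?ler_pdivrMr ?divr_ge0 //; lra.
  have := normr_ge0 (r - (s - 1) / 2); set X := `|r - _| in hr *.
  move=> X1.
  have h2 : `|(s - 1) / 2 / (1 + r)| * X <= 2 / 3 * X by rewrite ler_wpM2r.
  have h4 : 0 <= k%:R * X by rewrite mulr_ge0.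
  have k1 : 0 <= 1 + k.+1%:R / 2 :> R by rewrite -natr1; lra.
  apply: le_trans (ler_wpM2l k1 h2) _.
  rewrite -natr1; lra.
Qed.

End Expansion.

Section Upper.
Variables (R : realType) (a d s : R) (u v : int).
Hypotheses (aE : a - d = u%:~R) (adE : v%:~R * (a * d) = u%:~R).
Hypothesis v0 : v != 0.
Hypotheses (na : ~ rational a).
Hypothesis params : [/\ 9 <= a, 0 < d, a * d <= 1, 0 < s & s * s = 5].

(** A tail different from phi would be repelled beyond distance 1, although all later tails lie
    between 1 and 2. *)
Lemma golden_tail (xi : R) (M : int) :
  (forall p q e f x, cf_state xi p q e f x -> M <= e -> x < 2) ->
  forall p q e f x, cf_state xi p q e f x -> M <= e -> x = (1 + s) / 2.
Proof.
case: params => _ _ _ s0 ss hM p q e f x st Me.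
apply/eqP; rewrite -subr_eq0 -normr_le0 leNgt; apply/negP => X0.
have s1 : 2 < s by nra.
have s2 : s < 3 by nra.
have := archi_boundP (ltW (divr_gt0 (ltr0n R 2) X0)); rewrite ltr_pdivrMr //.
set k := Num.bound _ => hk.
have [p' [q' [e' [f' [x' [st' Me' hx _]]]]]] := cf_state_golden s0 ss hM k st Me.
have x1 := cf_tail_gt1 st'; have x2 := hM _ _ _ _ _ st' Me'.
have h1 : `|x' - (1 + s) / 2| <= 1 by rewrite ler_norml; lra.
lra.
Qed.

(** At r = 1 / phi the left side is exactly [level] times s; an error eta in r costs at most (a +
    [level] + eps) eta in total. *)
Lemma golden_limit_bound (r eps eta : R) : 0 <= r -> r <= 1 -> 0 <= eps -> 0 <= eta ->
  eta * (a + level a d s + eps) <= eps * s -> `|r - (s - 1) / 2| <= eta ->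
  `|(1 + s) / 2 - (a - 1)| * `|- d - 1 + r| <= (level a d s + eps) * ((1 + s) / 2 + r).
Proof.
case: (params) => ha hd0 had s0 ss r0 r1 eps0 eta0.
have [_ l1 _] := level_facts params.
have sn0 : s != 0 by rewrite gt_eqF.
have lE : level a d s * s = (a - 1 - (1 + s) / 2) * (d + 1 - (s - 1) / 2).
  by rewrite /level; field.
move: (level a d s) l1 lE => l l1 lE he; rewrite ler_norml => /andP[h1 h2].
have s2 : s < 3 by nra.
rewrite ler0_norm; last by lra.
rewrite ler0_norm; last by lra.
have h3 : (a - 1 - (1 + s) / 2) * (d + 1 - r) <= l * s + a * eta.
  rewrite lE.
  have h4 : (a - 1 - (1 + s) / 2) * ((s - 1) / 2 - r) <= a * eta.
    apply: le_trans (_ : (a - 1 - (1 + s) / 2) * eta <= _).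
      by rewrite ler_wpM2l; lra.
    by rewrite ler_wpM2r; lra.
  lra.
apply: le_trans (_ : (l + eps) * (s - eta) <= _); first by lra.
by rewrite ler_wpM2l; lra.
Qed.

Lemma shift1_denominators (r : R) : 0 <= r -> r <= 1 ->
  d / 2 <= `|a - 1 + r| * `|- d - 1 + r|.
Proof.
case: params => ha hd0 _ _ _ r0 r1.
rewrite ger0_norm; last by lra.
rewrite ler0_norm; last by lra.
have h8 : 8 * d <= (a - 1 + r) * - (- d - 1 + r) by apply: ler_pM; lra.
lra.
Qed.

(** Beyond a denominator N that makes the conjugates close enough, either some complete quotient is
    at least 2 and [exists_image_below_level] applies, or all are below 2, hence equal to phi, and t
    = a - 1 works in the limit. *)
Lemma Theta_approximation (xi eps e0 : R) : ~ rational xi -> 0 < eps -> 0 < e0 ->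
  exists b, [/\ Theta a b, `|b - galois_conj b| < e0 &
    2 * (`|xi - b| / `|b - galois_conj b|) <= 2 * level a d s / (a + d) + eps].
Proof.
move=> nxi eps0 e00; case: (params) => ha hd0 had s0 ss.
have [_ l1 _] := level_facts params.
have ad0 : 0 < a + d by lra.
have C0 : 0 < 2 * (a + d) / d by rewrite !divr_gt0 // mulr_gt0.
have := archi_boundP (ltW (divr_gt0 C0 e00)).
set N := Num.bound _ => hN.
have close (e : int) b : N%:Z <= e ->
    `|b - galois_conj b| <= 2 * (a + d) / d / e%:~R -> `|b - galois_conj b| < e0.
  move=> Ne /le_lt_trans; apply.
  have Ne' : N%:R <= e%:~R :> R by rewrite -[N%:R]/(N%:Z%:~R) ler_int.
  have Np : 0 < N%:R :> R by apply: le_lt_trans hN; rewrite divr_ge0 // ltW.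
  rewrite ltr_pdivrMr; last exact: lt_le_trans Ne'.
  move: hN; rewrite ltr_pdivrMr // => hN; apply: lt_le_trans hN _.
  by rewrite mulrC ler_pM2l.
have [[[[p q] [[e f] x]] /= [st Ne x2]]|hM] :=
  pselect (exists t : int * int * (int * int * R),
    [/\ cf_state xi t.1.1 t.1.2 t.2.1.1 t.2.1.2 t.2.2, N%:Z <= t.2.1.1 & 2 <= t.2.2]).
  case: st => h e1 f0 fe x1 nx E.
  have eR : 0 < e%:~R :> R by rewrite ltr0z.
  have r0 : 0 <= f%:~R / e%:~R :> R by rewrite divr_ge0 ?ler0z // ltW.
  have r1 : f%:~R / e%:~R <= 1 :> R by rewrite ler_pdivrMr // mul1r ler_int.
  have aE' : a = u%:~R + d by rewrite -aE; ring.
  have [m [n [hm hx hd]]] := exists_image_below_level (And3 ha hd0 had) (level_facts params) aE' x2 r0 r1.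
  have [b [bT bd bx]] := lft_point aE adE v0 na ad0 h hm e1 f0 x1 hd0 E hx hd.
  exists b; split => //; first exact: close bd.
  by apply: le_trans bx _; rewrite lerDl ltW.
have {}hM p q e f x : cf_state xi p q e f x -> N%:Z <= e -> x < 2.
  move=> st Ne; rewrite ltNge; apply/negP => x2; apply: hM.
  by exists (p, q, (e, f, x)).
have [p0 [q0 [e0' [f0' [x0 [st0 Ne0 _]]]]]] := cf_state_large nxi N.
(* Chosen so that 2 eps' / (a + d) = eps; [eta] below then turns the hypothesis of
   [golden_limit_bound] into an equality. *)
pose eps' := eps * (a + d) / 2.
have eps'0 : 0 < eps' by rewrite divr_gt0 // mulr_gt0.
have den0 : 0 < a + level a d s + eps' by lra.
pose eta := eps' * s / (a + level a d s + eps').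
have eta0 : 0 < eta by rewrite divr_gt0 // mulr_gt0.
have := archi_boundP (ltW (divr_gt0 (ltr0n R 2) eta0)); rewrite ltr_pdivrMr //.
set k := Num.bound _ => hk.
have [p [q [e [f [x [st Ne _ hr]]]]]] := cf_state_golden s0 ss hM k st0 Ne0.
have xE := golden_tail hM st Ne.
case: st => h e1 f0 fe x1 nx E.
have eR : 0 < e%:~R :> R by rewrite ltr0z.
set r := f%:~R / e%:~R in hr.
have r0 : 0 <= r by rewrite divr_ge0 ?ler0z // ltW.
have r1 : r <= 1 by rewrite ler_pdivrMr // mul1r ler_int.
have hr' : `|r - (s - 1) / 2| <= eta.
  have k0 : 0 < 1 + k%:R / 2 :> R by rewrite ltr_pwDl // divr_ge0.
  rewrite -(ler_pM2l k0); apply: le_trans hr _; lra.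
have hx : `|x - (1%:~R * a + (-1)%:~R)| * `|1%:~R * - d + (-1)%:~R + r| <=
    (level a d s + eps') * (x + r).
  rewrite xE !rmorphN !rmorph1 !mul1r.
  apply: golden_limit_bound hr' => //; [exact: ltW|exact: ltW|].
  by rewrite /eta divfK // gt_eqF.
have hd : d / 2 <= `|1%:~R * a + (-1)%:~R + r| * `|1%:~R * - d + (-1)%:~R + r|.
  by rewrite !rmorphN !rmorph1 !mul1r; exact: shift1_denominators.
have [b [bT bd bx]] := lft_point aE adE v0 na ad0 h
  (erefl : (1 : int) ^+ 2 = 1) e1 f0 x1 hd0 E hx hd.
exists b; split => //; first exact: close bd.
apply: le_trans bx _; rewrite /eps' le_eqVlt; apply/orP; left; apply/eqP.
by field; rewrite gt_eqF.
Qed.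

End Upper.

(** * Periodic continued fractions *)

Lemma rational_sqrt_nat (R : realType) (x : R) (k : nat) : rational x ->
  x ^+ 2 = k%:R -> exists c, k = (c ^ 2)%N.
Proof.
move=> /rationalP[n [b ->]] h.
(* A zero denominator is allowed here; the quotient is then 0 by convention. *)
have [b0|b0] := eqVneq b 0%N.
  exists 0%N; apply/eqP; rewrite -(eqr_nat R) -h b0 invr0 mulr0.
  by rewrite expr0n.
have bR : (b%:R : R) != 0 by rewrite pnatr_eq0.
have h2 : (absz n ^ 2 = k * b ^ 2)%N.
  apply/eqP; rewrite -(eqr_nat R) natrM !natrX -h expr_div_n divfK ?expf_neq0 //.
  by rewrite natr_absz intr_norm real_normK ?num_real.
have : (b %| absz n)%N by rewrite -(@dvdn_pexp2r _ _ 2) // h2 dvdn_mull.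
move/dvdnP => [c cE]; exists c; move: h2; rewrite cE expnMn => /eqP.
by rewrite eqn_pmul2r ?expn_gt0 ?lt0n ?b0 // => /eqP.
Qed.

Section PeriodicCf.
Variable R : realType.

Let per (u v : int) (k : nat) := if odd k then v else u.

Lemma cf_convergent_periodicS (u v : int) (n : nat) :
  cf_convergent R (per u v) n.+1 = u%:~R + (cf_convergent R (per v u) n)^-1.
Proof.
rewrite /=; congr (_ + (cf_convergent _ _ _)^-1).
by apply: funext => k; rewrite /per /=; case: (odd k).
Qed.

Lemma cf_convergent_periodic_ge (u v : int) (n : nat) : 9 <= u -> 9 <= v ->
  (9 : R) <= cf_convergent R (per u v) n.
Proof.
elim: n u v => [|n IH] u v hu hv; first by rewrite /= (ler_int _ 9).
rewrite cf_convergent_periodicS.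
have := IH v u hv hu; set c := cf_convergent _ _ _ => hc.
by rewrite ler_wpDr ?invr_ge0 ?(ler_int _ 9) //; lra.
Qed.

(** Inversion divides the distance by c t2 >= 81 and exchanges u with v. The geometric decay is
    weakened to [harmonic], a convenient null sequence. *)
Lemma cf_convergent_periodic_dist (u v : int) (n : nat) (t1 t2 : R) :
  9 <= u -> 9 <= v -> 0 < t1 -> 0 < t2 ->
  t1 = u%:~R + t2^-1 -> t2 = v%:~R + t1^-1 ->
  `|cf_convergent R (per u v) n - t1| <= harmonic n.
Proof.
elim: n u v t1 t2 => [|n IH] u v t1 t2 hu hv t10 t20 E1 E2.
  have v9 : (9 : R) <= v%:~R by rewrite (ler_int _ 9).
  have t2i : 0 < t1^-1 by rewrite invr_gt0.
  rewrite /= E1 opprD addNKr normrN ger0_norm ?invr_ge0 ?(ltW t20) // invr1.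
  by rewrite invf_le1 //; lra.
rewrite cf_convergent_periodicS E1.
have := IH v u t2 t1 hv hu t20 t10 E2 E1.
have := cf_convergent_periodic_ge n hv hu; set c := cf_convergent _ _ _ => hc hd.
have v9 : (9 : R) <= v%:~R by rewrite (ler_int _ 9).
have t2i : 0 < t1^-1 by rewrite invr_gt0.
have t29 : 9 <= t2 by lra.
have -> : u%:~R + c^-1 - (u%:~R + t2^-1) = - (c - t2) / (c * t2).
  by field; rewrite !gt_eqF //; lra.
rewrite normrM normrN normfV (@gtr0_norm _ (c * t2)); last by rewrite mulr_gt0 //; lra.
rewrite ler_pdivrMr ?mulr_gt0 //; last by lra.
apply: le_trans hd _; rewrite /harmonic.
have n0 : 0 <= n%:R :> R by [].
have n1 : 0 < n.+1%:R :> R by [].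
have n2 : 0 < n.+2%:R :> R by [].
have ct : 81 <= c * t2 by apply: le_trans (_ : 9 * 9 <= _); [lra|apply: ler_pM; lra].
rewrite -ler_pdivrMl ?invr_gt0 // invrK ler_pdivrMr //.
apply: le_trans (_ : 81 * n.+1%:R <= _); last by rewrite ler_pM2r.
rewrite -!natr1; lra.
Qed.

Lemma periodic_cf2E (u v : int) (t1 t2 : R) :
  9 <= u -> 9 <= v -> 0 < t1 -> 0 < t2 ->
  t1 = u%:~R + t2^-1 -> t2 = v%:~R + t1^-1 -> periodic_cf2 R u v = t1.
Proof.
move=> hu hv t10 t20 E1 E2; apply: cvg_lim => //.
apply/subr_cvg0/norm_cvg0P.
apply: (@squeeze_cvgr _ _ _ _ (fun=> 0) harmonic); last 2 first.
- exact: cvg_cst.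
- exact: cvg_harmonic.
by near=> n; rewrite normr_ge0 /=; apply: cf_convergent_periodic_dist E1 E2.
Unshelve. all: by end_near.
Qed.

Lemma periodic_fixpoints (u v : int) : 9 <= u -> 9 <= v ->
  exists t1 t2 : R, [/\ 0 < t1, 0 < t2, t1 = u%:~R + t2^-1 & t2 = v%:~R + t1^-1].
Proof.
move=> hu hv.
have u9 : (9 : R) <= u%:~R by rewrite (ler_int _ 9).
have v9 : (9 : R) <= v%:~R by rewrite (ler_int _ 9).
set U : R := u%:~R in u9 *; set V : R := v%:~R in v9 *.
have w0 : 0 < U * V by rewrite mulr_gt0 //; lra.
pose r := Num.sqrt ((U * V) ^+ 2 + 4 * (U * V)).
have rr : r ^+ 2 = (U * V) ^+ 2 + 4 * (U * V).
  by rewrite sqr_sqrtr // addr_ge0 ?sqr_ge0 // mulr_ge0 // ltW.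
have r0 : 0 <= r := sqrtr_ge0 _.
have wr : 0 < U * V + r by lra.
have U0 : U != 0 by rewrite gt_eqF //; lra.
have V0 : V != 0 by rewrite gt_eqF //; lra.
have key : (U * V + r) ^+ 2 = 2 * (U * V) * (U * V + r) + 4 * (U * V).
  by rewrite sqrrD rr; ring.
(* The positive root of v X^2 - u v X - u, and the same with u and v exchanged. *)
exists ((U * V + r) / (2 * V)), ((U * V + r) / (2 * U)).
have wr0 : U * V + r != 0 by rewrite gt_eqF.
have pos Z : 9 <= Z -> 0 < (U * V + r) / (2 * Z).
  by move=> hz; rewrite divr_gt0 // mulr_gt0 //; lra.
have inj Z W : Z != 0 -> W != 0 -> U * V = Z * W ->
    (U * V + r) / (2 * W) = Z + ((U * V + r) / (2 * Z))^-1.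
  move=> Z0 W0 E; apply/eqP; rewrite -subr_eq0.
  have -> : (U * V + r) / (2 * W) - (Z + ((U * V + r) / (2 * Z))^-1) =
      ((U * V + r) ^+ 2 - 2 * (Z * W) * (U * V + r) - 4 * (Z * W)) / (2 * W * (U * V + r)).
    by field; rewrite W0 wr0 Z0.
  by rewrite key -E; apply/eqP; rewrite (_ : _ - _ - _ = 0) ?mul0r //; ring.
by split; [exact: pos|exact: pos|exact: inj|apply: inj => //; rewrite mulrC].
Qed.

End PeriodicCf.

(** The discriminant (u v)^2 + 4 u v lies strictly between (u v + 1)^2 and (u v + 2)^2, so it is not
    a square. *)
Lemma periodic_irrational (R : realType) (u v : int) (a d : R) : 9 <= u -> 9 <= v ->
  a - d = u%:~R -> v%:~R * (a * d) = u%:~R -> ~ rational a.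
Proof.
move=> hu hv aE adE ha.
have hd : rational d.
  rewrite (_ : d = a - u%:~R); last by rewrite -aE; ring.
  by apply: rationalB => //; exact: rational_int.
have hr : rational (v%:~R * (a + d)).
  by apply: rationalM (rational_int _ _) (rationalD _ _).
have sq : (v%:~R * (a + d)) ^+ 2 = (absz ((u * v) ^+ 2 + 4 * (u * v)))%:R.
  have -> : (v%:~R * (a + d)) ^+ 2 = (v%:~R * (a - d)) ^+ 2 + 4 * v%:~R * (v%:~R * (a * d)) by ring.
  rewrite aE adE natr_absz ger0_norm; last by rewrite addr_ge0 ?sqr_ge0 //; nia.
  ring.
have [c cE] := rational_sqrt_nat hr sq.
have w1 : 81 <= u * v by nia.
have cE' : (u * v) ^+ 2 + 4 * (u * v) = c%:Z ^+ 2.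
  by move: cE; rewrite -[(c ^ 2)%N]/(absz (c ^ 2)%N); nia.
have [h|h] := leP c%:Z (u * v + 1); nia.
Qed.

(** * The Hurwitz constant as a limit inferior *)

Lemma approx_constant_le (R : realType) (a xi K : R) :
  (forall eps e : R, 0 < eps -> 0 < e -> exists b, [/\ Theta a b,
    `|b - galois_conj b| < e & 2 * (`|xi - b| / `|b - galois_conj b|) <= K + eps]) ->
  (approx_constant a xi <= K%:E)%E.
Proof.
move=> H; rewrite /approx_constant limf_einfE; apply: ge_ereal_sup => _ [V [e e0 eV] <-].
apply/lee_addgt0Pr => eps eps0.
have [b [bT be bK]] := H _ _ eps0 e0.
apply: (@le_trans _ _ (2 * (`|xi - b| / `|b - galois_conj b|))%:E); last by rewrite lee_fin.
by apply: ereal_inf_lbound; exists b => //; exact: eV.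
Qed.

Lemma approx_constant_ge (R : realType) (a xi K : R) :
  (forall eps : R, 0 < eps -> exists2 e : R, 0 < e & forall b, Theta a b ->
    `|b - galois_conj b| < e ->
    K - eps <= 2 * (`|xi - b| / `|b - galois_conj b|)) ->
  (K%:E <= approx_constant a xi)%E.
Proof.
move=> H; rewrite /approx_constant limf_einfE; apply/lee_subgt0Pr => eps eps0.
have [e e0 eH] := H _ eps0.
apply: le_trans (ereal_sup_ubound _); last first.
  exists [set b | Theta a b /\ `|b - galois_conj b| < e]; last by [].
  by exists e.
by apply: le_ereal_inf_tmp => _ [b [bT be] <-]; rewrite -EFinB lee_fin; exact: eH.
Qed.

Theorem theorem1p2 (R : realType) (u v : int) (hu : 9 <= u) (huv : u <= v) :
  let beta_uv : R := periodic_cf2 R u v in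
  let tau1 : R := periodic_cf2 R u v in
  let tau2 : R := periodic_cf2 R v u in
  let phi : R := golden_ratio R in
  is_Hurwitz_constant beta_uv
    (2 * (tau1 - phi ^+ 2) * (1 + tau2 / phi ^+ 2)
       / ((phi + phi^-1) * (tau1 * tau2 + 1)))%:E.
Proof.
have hv : 9 <= v by exact: le_trans huv.
have [t1 [t2 [t10 t20 E1 E2]]] := @periodic_fixpoints R u v hu hv.
rewrite /= (periodic_cf2E hu hv t10 t20 E1 E2) (periodic_cf2E hv hu t20 t10 E2 E1).
set s : R := Num.sqrt 5.
have s0 : 0 < s by rewrite sqrtr_gt0.
have ss : s * s = 5 by rewrite -expr2 sqr_sqrtr.
have t2n : t2 != 0 by rewrite gt_eqF.
have d0 : 0 < t2^-1 by rewrite invr_gt0.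
have aE : t1 - t2^-1 = u%:~R by rewrite {1}E1 addrK.
have adE : v%:~R * (t1 * t2^-1) = u%:~R.
  have h : v%:~R * t1 = u%:~R * t2.
    have h1 : t1 * t2 = u%:~R * t2 + 1 by rewrite {1}E1 mulrDl mulVf.
    have h2 : t1 * t2 = v%:~R * t1 + 1 by rewrite {1}E2 mulrDr divff ?gt_eqF // mulrC.
    by apply: (addIr 1); rewrite -h1 -h2.
  by rewrite mulrA h mulfK.
have uR : (9 : R) <= u%:~R by rewrite (ler_int _ 9).
have vR : (9 : R) <= v%:~R by rewrite (ler_int _ 9).
have params : [/\ 9 <= t1, 0 < t2^-1, t1 * t2^-1 <= 1, 0 < s & s * s = 5].
  split => //; first by rewrite E1; lra.
  have v0 : 0 < v%:~R :> R by lra.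
  by rewrite -(ler_pM2l v0) adE mulr1 ler_int.
have na := periodic_irrational hu hv aE adE.
have [_ l1 _] := level_facts params.
have l0 : 0 < level t1 t2^-1 s by lra.
have ad0 : 0 < t1 + t2^-1 by rewrite addr_gt0.
have v0 : v != 0 by rewrite gt_eqF // (lt_le_trans _ hv).
have s2 : 2 < s by nra.
(* Uses phi^2 = (3 + s) / 2, phi^-2 = (3 - s) / 2 and phi + phi^-1 = s, after division of numerator
   and denominator by tau2. *)
have -> : 2 * (t1 - golden_ratio R ^+ 2) * (1 + t2 / golden_ratio R ^+ 2)
       / ((golden_ratio R + (golden_ratio R)^-1) * (t1 * t2 + 1)) =
  2 * level t1 t2^-1 s / (t1 + t2^-1).
  have p2 : golden_ratio R ^+ 2 = (3 + s) / 2.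
    rewrite /golden_ratio -/s -[LHS]addr0 -(_ : (5 - s * s) / 4 = 0).
      by field.
    by rewrite ss subrr mul0r.
  have p1 : (golden_ratio R)^-1 = (s - 1) / 2.
    rewrite /golden_ratio -/s; apply: (mulIf (_ : (1 + s) / 2 != 0)).
      by rewrite gt_eqF //; lra.
    rewrite mulVf; last by rewrite gt_eqF //; lra.
    rewrite -[LHS]addr0 -(_ : (s * s - 5) / 4 = 0); last by rewrite ss subrr mul0r.
    by field.
  have p2' : ((3 + s) / 2)^-1 = (3 - s) / 2.
    apply: (mulIf (_ : (3 + s) / 2 != 0)); first by rewrite gt_eqF //; lra.
    rewrite mulVf; last by rewrite gt_eqF //; lra.
    rewrite -[LHS]addr0 -(_ : (5 - s * s) / 4 = 0); last by rewrite ss subrr mul0r.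
    by field.
  rewrite p1 p2 p2' /level (_ : golden_ratio R + _ = s); last by rewrite /golden_ratio -/s; field.
  field; rewrite t2n !gt_eqF //=; last by rewrite ltr_wpDl // mulr_ge0 // ltW.
have upper xi : ~ rational xi ->
    (approx_constant t1 xi <= (2 * level t1 t2^-1 s / (t1 + t2^-1))%:E)%E.
  move=> nxi; apply: approx_constant_le => eps e eps0 e0.
  by apply: (Theta_approximation aE adE v0 na params).
have ng : ~ rational ((1 + s) / 2).
  move=> hg; have hs : rational s.
    have -> : s = (1 + s) / 2 + (1 + s) / 2 - 1%:~R by field.
    by apply: rationalB (rational_int _ _); apply: rationalD.
  have [c] := @rational_sqrt_nat R s 5 hs ss.
  by case: c => [|[|[|c]]] //; rewrite -addn3; lia.
split.
  (* The maximum is attained at the golden ratio. *)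
  exists ((1 + s) / 2).
    by case => // gT; apply: (golden_notin_Theta hu huv aE adE na s0 ss ad0 l0).
  apply/le_anti/andP; split; first exact: upper.
  apply: approx_constant_ge => eps eps0.
  exact: (golden_lower hu huv aE adE na s0 ss ad0 l0).
by move=> _ [xi nxi <-]; apply: upper => h; apply: nxi; left.
Qed.
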